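(* For a positive integer $k$, let $m_k$ be the minimum order of a connected graph $G$ with $c(G)\geq k$; for a positive integer $n$ let $f_k(n)$ be the number of isomorphism classes of connected graphs $G$ of order $n$ with $c(G)=k$, and let $g(n)$ be the number of isomorphism classes of (not necessarily connected) graphs of order $n$. Then: (1) for all $n>1$, $g(n-1)\leq f_1(n)$; (2) for all $k>1$ and all $n>2m_k$, $g(n-m_k-1)\leq f_k(n)$.
   Context: Cops and Robbers is played on a finite, connected, undirected graph $G$. Cops first each choose a starting vertex, then the robber does; thereafter players alternate rounds, cops first, each player moving to an adjacent vertex or staying put (several cops may share a vertex). The cops win if some cop eventually occupies the robber's vertex. The cop number $c(G)$ is the minimum number of cops that have a winning strategy. *)

(* Defs.v *)
From HB Require Import structures.
From mathcomp Require Import all_boot all_fingroup all_algebra.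
From mathcomp Require Import boolp.

Set Implicit Arguments.
Unset Strict Implicit.
Unset Printing Implicit Defensive.

(* Finite simple undirected graphs on the vertex set V, given by the set of
   ordered pairs of adjacent vertices. *)
Definition sgraph_axiom (V : finType) (E : {set V * V}) : bool :=
  [forall x, (x, x) \notin E] &&
  [forall x, forall y, ((x, y) \in E) == ((y, x) \in E)].

Record sgraph (V : finType) := SGraph {
  arcs :> {set V * V};
  arcsP : sgraph_axiom arcs }.

HB.instance Definition _ (V : finType) := [isSub for @arcs V].
HB.instance Definition _ (V : finType) := [Finite of sgraph V by <:].

Definition adj (V : finType) (G : sgraph V) : rel V :=
  fun x y => (x, y) \in arcs G.

Lemma adjC (V : finType) (G : sgraph V) : symmetric (adj G).
Proof.
by move=> x y; case/andP: (arcsP G) => _ /forallP/(_ x)/forallP/(_ y)/eqP.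
Qed.

Lemma adjxx (V : finType) (G : sgraph V) : irreflexive (adj G).
Proof.
by move=> x; apply: negbTE; case/andP: (arcsP G) => /forallP/(_ x).
Qed.

(* The graph without vertices is not connected. *)
Definition connected_graph (V : finType) (G : sgraph V) : bool :=
  (0 < #|V|) && [forall x, forall y, connect (adj G) x y].

Definition sgraph_iso (V : finType) (G H : sgraph V) : bool :=
  [exists p : {perm V}, forall x, forall y, adj H (p x) (p y) == adj G x y].

Lemma sgraph_iso_equivalence (V : finType) : equivalence_rel (@sgraph_iso V).
Proof.
have isoP (G H : sgraph V) :
    reflect (exists p : {perm V}, forall x y, adj H (p x) (p y) = adj G x y)
            (sgraph_iso G H).
  apply: (iffP existsP) => -[p pP]; exists p.
    by move=> x y; apply/eqP; move/forallP/(_ x)/forallP: pP; apply.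
  by apply/forallP => x; apply/forallP => y; rewrite pP.
have iso_sym (G H : sgraph V) : sgraph_iso G H -> sgraph_iso H G.
  case/isoP=> p pP; apply/isoP; exists (p^-1)%g => x y.
  by rewrite -pP !permKV.
have iso_trans (G H K : sgraph V) :
    sgraph_iso G H -> sgraph_iso H K -> sgraph_iso G K.
  move=> /isoP[p pP] /isoP[q qP]; apply/isoP; exists (p * q)%g => x y.
  by rewrite !permM qP pP.
move=> G H K; split; first by apply/isoP; exists 1%g => x y; rewrite !perm1.
move=> GH; apply/idP/idP; [exact/iso_trans/iso_sym | exact: iso_trans].
Qed.

Definition step (V : finType) (G : sgraph V) (x y : V) : bool :=
  (x == y) || adj G x y.

(* A strategy for k cops maps the list of the vertices occupied by the robber
   so far, in chronological order, to the current positions of the cops: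
   s [::] is their initial placement, and s [:: r_0; ...; r_t] are their
   positions after they have answered the robber's placement at r_0 and his
   moves to r_1, ..., r_t. *)
Definition cop_strategy (V : finType) (k : nat) : Type := seq V -> 'I_k -> V.

Definition legal_strategy (V : finType) (G : sgraph V) (k : nat)
    (s : cop_strategy V k) : Prop :=
  forall (h : seq V) (r : V) (i : 'I_k), step G (s h i) (s (rcons h r) i).

Definition robber_walk (V : finType) (G : sgraph V) (rho : nat -> V) : Prop :=
  forall t, step G (rho t) (rho t.+1).

(* While the robber is at rho t, the cops are first at s (mkseq rho t) and,
   after their answer, at s (mkseq rho t.+1). *)
Definition captured (V : finType) (k : nat) (s : cop_strategy V k)
    (rho : nat -> V) : Prop :=
  exists t, exists i, s (mkseq rho t) i = rho t \/ s (mkseq rho t.+1) i = rho t.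

Definition cops_win (V : finType) (G : sgraph V) (k : nat) : Prop :=
  exists s : cop_strategy V k, legal_strategy G s /\
    forall rho : nat -> V, robber_walk G rho -> captured s rho.

Lemma cops_win_card (V : finType) (G : sgraph V) : cops_win G #|V|.
Proof.
exists (fun _ i => enum_val i); split=> [h r i|rho _].
  by rewrite /step eqxx.
by exists 0, (enum_rank (rho 0)); left; rewrite enum_rankK.
Qed.

Lemma cop_number_subproof (V : finType) (G : sgraph V) :
  exists k, `[< cops_win G k >].
Proof. by exists #|V|; apply/asboolP/cops_win_card. Qed.

Definition cop_number (V : finType) (G : sgraph V) : nat :=
  ex_minn (cop_number_subproof G).

(* Aigner and Fromme: minimum degree at least k and girth at least 5 imply
   cop number at least k. *)
Lemma cop_number_lb (V : finType) (G : sgraph V) (k : nat) (v0 : V) :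
  (forall r, k <= #|[set w | adj G r w]|) ->
  (forall u r, u != r -> #|[set w | adj G r w & step G u w]| <= 1) ->
  k <= cop_number G.
Proof.
move=> degG codegG; rewrite /cop_number; case: ex_minnP => c /asboolP.
case=> s [sL sW] _; rewrite leqNgt; apply/negP => ltck.
have [r0 r0P] : exists r0, forall i, s [::] i != r0.
  have : #|[set s [::] i | i : 'I_c]| < #|[set: V]|.
    apply: (leq_ltn_trans (leq_imset_card _ _)); rewrite card_ord.
    by apply: (leq_trans ltck); apply: (leq_trans (degG v0)); rewrite cardsT max_card.
  move=> lt; have /properP[_ [r _ rN]] :
      [set s [::] i | i : 'I_c] \proper [set: V].
    by rewrite properEcard subsetT.
  by exists r => i; apply: contraNneq rN => <-; apply: imset_f.
pose esc (C : 'I_c -> V) r :=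
  odflt r [pick w | adj G r w & [forall i, ~~ step G (C i) w]].
have escP (C : 'I_c -> V) r : (forall i, C i != r) ->
    adj G r (esc C r) /\ forall i, ~~ step G (C i) (esc C r).
  move=> Cr; rewrite /esc; case: pickP => [w /andP[? /forallP] //|no].
  have sub : [set w | adj G r w] \subset
      \bigcup_(i < c) [set w | adj G r w & step G (C i) w].
    apply/subsetP => w; rewrite inE => rw; apply/bigcupP.
    have := no w; rewrite rw /= => /negbT; rewrite negb_forall.
    by case/existsP=> i; rewrite negbK => iw; exists i; rewrite // inE rw.
  have /leq_trans/(_ (subset_leq_card sub)) := degG r.
  suff le: #|\bigcup_(i < c) [set w | adj G r w & step G (C i) w]| <= c.
    by move/leq_trans/(_ le); rewrite leqNgt ltck.
  rewrite -[X in _ <= X]card_ord -[X in _ <= X]sum1_card.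
  elim/big_rec2: _ => [|i n A _ IH]; first by rewrite cards0.
  apply: (leq_trans (leq_card_setU _ _)); apply: leq_add IH.
  exact: codegG.
pose fix hist t := if t is t'.+1
  then rcons (hist t') (esc (s (hist t')) (last r0 (hist t'))) else [::].
pose rho t := last r0 (hist t.+1).
have histS t : hist t.+1 = rcons (hist t) (rho t) by rewrite /rho /= last_rcons.
have mkrho t : mkseq rho t = hist t.
  elim: t => // t IH; rewrite histS -IH /mkseq -addn1 iotaD map_cat /=.
  by rewrite cats1.
have inv t : (forall i, s (hist t) i != last r0 (hist t)) ->
    [/\ adj G (last r0 (hist t)) (rho t),
        forall i, s (hist t) i != rho t & forall i, s (hist t.+1) i != rho t].
  move/escP => [a st]; have -> : rho t = esc (s (hist t)) (last r0 (hist t)).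
    by rewrite /rho /= last_rcons.
  split=> // i; apply: contraNneq (st i); first by move->; rewrite /step eqxx.
  by move <-; apply: sL.
have safe t : forall i, s (hist t) i != last r0 (hist t).
  elim: t => [//|t /inv[_ _ IH] i]; exact: IH.
have [t|t [i]] := sW rho.
  by have [a _ _] := inv _ (safe t.+1); rewrite /step; apply/orP; right.
rewrite !mkrho; have [_ h1 h2] := inv _ (safe t).
by case=> /eqP; [rewrite (negbTE (h1 i)) | rewrite (negbTE (h2 i))].
Qed.

(* Connected graphs of arbitrarily large cop number exist: point-line
   incidence graphs of affine planes without the vertical lines. *)
Lemma mincop_order_subproof (k : nat) :
  exists m, [exists G : sgraph 'I_m, connected_graph G && (k <= cop_number G)].
Proof.
have [p ltkp p_pr] := prime_above k.
pose V : finType := (bool * 'F_p * 'F_p)%type.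
pose e : rel V := fun u v =>
  (u.1.1 != v.1.1) && (u.2 + v.2 == u.1.2 * v.1.2)%R.
have eC : symmetric e.
  by move=> u v; rewrite /e eq_sym GRing.addrC GRing.mulrC.
exists #|V|; pose E := [set xy : 'I_#|V| * 'I_#|V| |
  e (enum_val xy.1) (enum_val xy.2)].
have EP : sgraph_axiom E.
  apply/andP; split; apply/forallP => x; first by rewrite inE /e eqxx.
  by apply/forallP => y; rewrite !inE eC.
apply/existsP; exists (SGraph EP).
have adjE x y : adj (SGraph EP) x y = e (enum_val x) (enum_val y).
  by rewrite /adj inE.
pose v0 : 'I_#|V| := enum_rank (false, 0%R, 0%R).
apply/andP; split; last first.
  apply: (cop_number_lb v0) => [r|u r neq_ur].
    case Er: (enum_val r) => [[a x] y].
    pose nb (m : 'F_p) : 'I_#|V| := enum_rank (~~ a, m, (x * m - y)%R).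
    have nbI : injective nb by move=> m m' /enum_rank_inj[].
    apply: (leq_trans (ltnW ltkp)).
    rewrite -[X in X <= _](card_Fp p_pr) -(card_imset _ nbI).
    apply: subset_leq_card; apply/subsetP => _ /imsetP[m _ ->].
    rewrite inE adjE Er /e enum_rankK /= GRing.addrC GRing.subrK eqxx.
    by rewrite andbT; case: (a).
  rewrite leqNgt; apply/negP => /card_gt1P[w [w' [wP w'P /negP]]]; apply.
  move: wP w'P neq_ur; rewrite !inE /step !adjE.
  rewrite -!(inj_eq enum_val_inj).
  case: (enum_val u) (enum_val r) (enum_val w) (enum_val w') =>
    [[a x] y] [[a' x'] y'] [[b m] c] [[b' m'] c'].
  rewrite /e /= => /andP[/andP[ab /eqP e1] h] /andP[/andP[ab' /eqP e2] h'] ne.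
  have bb' : b = b' by move: ab ab'; case: (a') (b) (b') => [] [] [].
  subst b'; case/orP: h; case/orP: h'.
  - by move=> /eqP <- /eqP <-.
  - by move=> /andP[/eqP n _] /eqP[z _ _]; case: n.
  - by move=> /eqP[z _ _] /andP[/eqP n _]; case: n.
  move=> /andP[ab1 /eqP e3] /andP[_ /eqP e4].
  have aa' : a = a' by move: ab ab1; case: (a) (a') (b) => [] [] [].
  subst a'.
  have key : ((x - x') * m = (x - x') * m')%R.
    rewrite !GRing.mulrBl -e1 -e2 -e3 -e4.
    by rewrite !GRing.opprD !GRing.addrA (GRing.addrAC y c) GRing.addrK
               (GRing.addrAC y c') GRing.addrK.
  have [xx|nx] := eqVneq x x'.
    subst x'; move: ne; rewrite !xpair_eqE !eqxx /=.
    have -> : y = y' by apply: (@GRing.addIr _ c); rewrite e4 e1.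
    by rewrite eqxx.
  have mm : m = m'.
    by apply: (GRing.mulfI _ key); rewrite GRing.subr_eq0.
  by subst m'; have -> : c = c' by apply: (@GRing.addrI _ y'); rewrite e1 e2.
apply/andP; split.
  by rewrite card_ord; apply/card_gt0P; exists (false, 0%R, 0%R).
have conn1 u v : e u v -> connect (adj (SGraph EP)) (enum_rank u) (enum_rank v).
  by move=> uv; apply: connect1; rewrite adjE !enum_rankK.
have conn2 a (x y x' y' : 'F_p) : x != x' ->
    connect (adj (SGraph EP)) (enum_rank (a, x, y)) (enum_rank (a, x', y')).
  move=> nx; pose m := ((y' - y) / (x' - x))%R.
  apply: (connect_trans (conn1 (a, x, y) (~~ a, m, (x * m - y)%R) _)).
    by rewrite /e /= GRing.addrC GRing.subrK eqxx andbT; case: (a).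
  apply: conn1; rewrite /e /=; apply/andP; split; first by case: (a).
  have mE : (m * (x' - x) = y' - y)%R.
    by rewrite GRing.mulfVK // GRing.subr_eq0 eq_sym.
  by rewrite -GRing.addrA [(- y + _)%R]GRing.addrC -mE GRing.mulrBr
             (GRing.mulrC x) GRing.addrC GRing.subrK.
have conn3 a (x y x' y' : 'F_p) :
    connect (adj (SGraph EP)) (enum_rank (a, x, y)) (enum_rank (a, x', y')).
  have [<-|] := eqVneq x x'; last exact: conn2.
  have n1 : (x + 1 != x)%R.
    by rewrite -GRing.subr_eq0 GRing.addrAC GRing.subrr GRing.add0r GRing.oner_neq0.
  by apply: (@connect_trans _ _ (enum_rank (a, x + 1, 0)%R)); apply: conn2;
     rewrite // eq_sym.
apply/forallP => u; apply/forallP => v.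
rewrite -(enum_valK u) -(enum_valK v).
case: (enum_val u) (enum_val v) => [[a x] y] [[b m] c].
have [<-|ab] := eqVneq a b; first exact: conn3.
apply: (connect_trans (conn3 a x y 0%R (- c)%R)); apply: conn1.
by rewrite /e /= ab GRing.addNr GRing.mul0r eqxx.
Qed.

Definition mincop_order (k : nat) : nat := ex_minn (mincop_order_subproof k).

Definition iso_classes (V : finType) (S : {set sgraph V}) : {set {set sgraph V}} :=
  equivalence_partition (@sgraph_iso V) S.

Definition num_graphs (n : nat) : nat := #|iso_classes [set: sgraph 'I_n]|.

Definition num_cop_graphs (k n : nat) : nat :=
  #|iso_classes [set G : sgraph 'I_n | connected_graph G & cop_number G == k]|.

(* Main.v *)
Require Import Defs.
From mathcomp Require Import all_boot all_fingroup.
From mathcomp Require Import boolp.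
From mathcomp Require Import zify.

(** (1) Adding a universal vertex to an arbitrary graph [H] gives a connected
    graph of cop number 1 that determines [H].

    (2) Let [M] be a connected graph of order [m_k] with [c(M) >= k]. Deleting a
    non-cut vertex lowers the cop number by at most one, hence [c(M) = k] by
    minimality. Join a vertex [x] of [M] by an edge to the apex of the cone over
    an arbitrary graph [H] on [n - m_k - 1] vertices. Collapsing the cone to [x]
    is a retraction onto [M], so at least [k] cops are needed. Conversely, [k]
    cops play in [M] against the image of the robber; once a cop has caught this
    image, either the robber is caught or the cop is at [x] and wins by moving to
    the apex. As [n > 2 m_k], the apex is the vertex of largest degree, and the
    resulting graph determines [H]. *)

Set Implicit Arguments.
Unset Strict Implicit.
Unset Printing Implicit Defensive.

(** * Graphs from relations, isomorphism and connectedness *)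

Section GraphOfRel.
Variables (V : finType) (e : rel V).

(** Symmetrised and with the diagonal removed, so that the relations below may list an edge in one
    direction only and hold at loops. *)
Definition rel_arcs : {set V * V} :=
  [set xy | (xy.1 != xy.2) && (e xy.1 xy.2 || e xy.2 xy.1)].

Lemma rel_arcsP : sgraph_axiom rel_arcs.
Proof.
apply/andP; split; apply/forallP => x; first by rewrite inE eqxx.
by apply/forallP => y; rewrite !inE /= [y == x]eq_sym orbC.
Qed.

Definition graph_of_rel : sgraph V := SGraph rel_arcsP.

Lemma adj_graph_of_rel x y :
  adj graph_of_rel x y = (x != y) && (e x y || e y x).
Proof. by rewrite /adj inE. Qed.

End GraphOfRel.

Definition graph_preim (V W : finType) (f : W -> V) (G : sgraph V) : sgraph W :=
  graph_of_rel (fun x y => adj G (f x) (f y)).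

Lemma adj_graph_preim (V W : finType) (f : W -> V) (G : sgraph V) x y :
  adj (graph_preim f G) x y = adj G (f x) (f y).
Proof.
rewrite adj_graph_of_rel [adj G (f y) _]adjC orbb.
by case: eqVneq => [->|//]; rewrite adjxx.
Qed.

Definition degree (W : finType) (G : sgraph W) (y : W) : nat :=
  #|[set z | adj G y z]|.

Lemma step_refl (V : finType) (G : sgraph V) x : step G x x.
Proof. by rewrite /step eqxx. Qed.

Lemma sgraph_isoP (V : finType) (G H : sgraph V) :
  reflect (exists p : {perm V}, forall x y, adj H (p x) (p y) = adj G x y)
          (sgraph_iso G H).
Proof.
apply: (iffP existsP) => -[p pP]; exists p.
  by move=> x y; apply/eqP; move/forallP/(_ x)/forallP: pP; apply.
by apply/forallP => x; apply/forallP => y; rewrite pP.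
Qed.

Lemma connected_graphP (V : finType) (G : sgraph V) :
  reflect (0 < #|V| /\ forall x y, connect (adj G) x y) (connected_graph G).
Proof.
apply: (iffP andP) => -[V0 cG]; split=> //.
  by move=> x y; move/forallP/(_ x)/forallP: cG; apply.
by apply/forallP => x; apply/forallP => y.
Qed.

Lemma connected_graph_root (V : finType) (G : sgraph V) (u : V) :
  (forall x, connect (adj G) x u) -> connected_graph G.
Proof.
move=> cG; apply/connected_graphP; split=> [|x y].
  by apply/card_gt0P; exists u.
apply: connect_trans (cG x) _.
by rewrite (sym_connect_sym (@adjC _ G)).
Qed.

Lemma connect_homo (V W : finType) (e : rel V) (e' : rel W) (f : V -> W) x y :
  (forall a b, e a b -> e' (f a) (f b)) -> connect e x y ->
  connect e' (f x) (f y).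
Proof.
move=> ee' /connectP[p]; elim: p x => [|z p IH] x /=; first by move=> _ ->.
by move=> /andP[/ee'/connect1 xz zp] yE; apply: connect_trans xz (IH _ zp yE).
Qed.

(** * Comparing numbers of isomorphism classes *)

(** Each class is sent to the class of [F G] for a picked representative [G]; [F] is assumed to
    reflect isomorphism, which makes this map injective. *)
Lemma iso_classes_leq (V W : finType) (S : {set sgraph V}) (T : {set sgraph W})
    (F : sgraph V -> sgraph W) :
  {in S, forall G, F G \in T} ->
  {in S &, forall G H, sgraph_iso (F G) (F H) -> sgraph_iso G H} ->
  #|iso_classes S| <= #|iso_classes T|.
Proof.
move=> FT Finj.
have refl (G : sgraph W) : sgraph_iso G G by have [] := sgraph_iso_equivalence G G G.
pose cl (B : {set sgraph V}) := [set K in T | if [pick G in B] is Some G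
  then sgraph_iso (F G) K else false].
have blockP B : B \in iso_classes S -> exists G, [/\ G \in S,
    cl B = [set K in T | sgraph_iso (F G) K] & B = [set H in S | sgraph_iso G H]].
  case/imsetP=> G GS BE; rewrite /cl; case: pickP => [H|]; last first.
    by move/(_ G); rewrite BE inE GS /=; have [->] := sgraph_iso_equivalence G G G.
  rewrite BE inE => /andP[HS GH]; exists H; split=> //.
  apply/setP=> K; rewrite !inE; congr (_ && _).
  by have [_ /(_ GH) ->] := sgraph_iso_equivalence G H K.
rewrite -(card_in_imset (f := cl)).
  apply/subset_leq_card/subsetP=> _ /imsetP[B /blockP[G [GS -> _]] ->].
  by apply/imsetP; exists (F G) => //; apply: FT.
move=> B B' /blockP[G [GS -> ->]] /blockP[H [HS -> ->]] /setP/(_ (F H)).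
rewrite !inE FT //= refl => GH; apply/setP=> K; rewrite !inE.
have /Finj : sgraph_iso (F G) (F H) by [].
by move=> /(_ GS HS) {}GH; have [_ /(_ GH) ->] := sgraph_iso_equivalence G H K.
Qed.

(** * Cop numbers, retracts and transport of graphs *)

Lemma cop_number_leq (V : finType) (G : sgraph V) k :
  cops_win G k -> cop_number G <= k.
Proof. by rewrite /cop_number; case: ex_minnP => c _ + Gk; apply; apply/asboolP. Qed.

Lemma cop_number_win (V : finType) (G : sgraph V) : cops_win G (cop_number G).
Proof. by rewrite /cop_number; case: ex_minnP => c /asboolP. Qed.

Lemma cop_number_gt0 (V : finType) (G : sgraph V) (x : V) : 0 < cop_number G.
Proof.
have [s [_ /(_ (fun=> x))]] := cop_number_win G.
case: (cop_number G) s => // s []; last by move=> t [[]].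
by move=> t; apply: step_refl.
Qed.

Lemma map_mkseq (T U : Type) (f : T -> U) (g : nat -> T) n :
  map f (mkseq g n) = mkseq (f \o g) n.
Proof. by rewrite /mkseq -map_comp. Qed.

Lemma mkseqS_rcons (T : Type) (g : nat -> T) n :
  mkseq g n.+1 = rcons (mkseq g n) (g n).
Proof. by rewrite /mkseq -addn1 iotaD map_cat cats1. Qed.

(* The robber hides in the retract, and the cops there play the images of the
   moves of the cops of the whole graph. *)
Lemma cop_number_retract (V W : finType) (G : sgraph V) (H : sgraph W)
    (i : V -> W) (r : W -> V) :
  (forall x y, step G x y -> step H (i x) (i y)) ->
  (forall x y, step H x y -> step G (r x) (r y)) ->
  cancel i r -> cop_number G <= cop_number H.
Proof.
move=> iS rS ir; apply: cop_number_leq.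
have [s [sL sW]] := cop_number_win H.
exists (fun h j => r (s (map i h) j)); split=> [h v j|rho rhoW].
  by apply: rS; rewrite map_rcons; apply: sL.
have [|t [j]] := sW (i \o rho); first by move=> t; apply: iS.
by rewrite -!(map_mkseq i) => cap; exists t, j; case: cap => ->; [left|right];
   rewrite /= ir.
Qed.

(** Graphs on [W] are moved to ordinals along an enumeration; the two inverse bijections are
    retractions, so the cop number is kept. *)
Lemma num_graphs_leq (W : finType) (k h n : nat)
    (F : sgraph 'I_h -> sgraph W) :
  #|W| = n -> (forall H, connected_graph (F H)) ->
  (forall H, cop_number (F H) = k) ->
  (forall H H', sgraph_iso (F H) (F H') -> sgraph_iso H H') ->
  num_graphs h <= num_cop_graphs k n.
Proof.
move=> <- Fconn Fcop Finj.
pose f : 'I_#|W| -> W := enum_val; pose g : W -> 'I_#|W| := enum_rank.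
have fK : cancel f g := @enum_valK W; have gK : cancel g f := @enum_rankK W.
apply: (@iso_classes_leq _ _ _ _ (fun H => graph_preim f (F H))) => [H _|H H' _ _].
  rewrite inE; apply/andP; split.
    have /connected_graphP[W0 cF] := Fconn H.
    apply/connected_graphP; split=> [|x y]; first by rewrite card_ord.
    rewrite -[x]fK -[y]fK; apply: connect_homo (cF _ _) => a b ab.
    by rewrite adj_graph_preim !gK.
  have stepE x y : step (graph_preim f (F H)) x y = step (F H) (f x) (f y).
    by rewrite /step adj_graph_preim (can_eq fK).
  rewrite -(Fcop H) eqn_leq; apply/andP; split.
    apply: (@cop_number_retract _ _ _ _ f g) => // x y; rewrite stepE //.
    by rewrite !gK.
  by apply: (@cop_number_retract _ _ _ _ g f) => // x y; rewrite stepE // !gK.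
case/sgraph_isoP=> p pP; apply: Finj; apply/sgraph_isoP.
have qI : injective (f \o p \o g).
  by apply: inj_comp; [apply: inj_comp; [apply: can_inj fK | apply: perm_inj]
    | apply: can_inj gK].
exists (perm qI) => x y; have := pP (g x) (g y).
by rewrite !permE !adj_graph_preim /= !gK.
Qed.

(** Since [p] maps the image of [j] into itself, finiteness makes its restriction a permutation. *)
Lemma sgraph_iso_restrict (V W : finType) (G G' : sgraph V) (H H' : sgraph W)
    (j : W -> V) (p : {perm V}) :
  injective j ->
  (forall a b, adj G (j a) (j b) = adj H a b) ->
  (forall a b, adj G' (j a) (j b) = adj H' a b) ->
  (forall x y, adj G' (p x) (p y) = adj G x y) ->
  (forall a, exists b, p (j a) = j b) -> sgraph_iso H H'.
Proof.
move=> jI GH GH' pP pj.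
have pjb a : exists b, p (j a) == j b by have [b ->] := pj a; exists b.
pose q a := xchoose (pjb a).
have qP a : p (j a) = j (q a) by apply/eqP; apply: xchooseP (pjb a).
have qI : injective q by move=> a b qab; apply/jI/(@perm_inj _ p); rewrite !qP qab.
apply/sgraph_isoP; exists (perm qI) => a b.
by rewrite !permE -GH' -!qP pP GH.
Qed.

(** * Cones *)

Section Cone.
Variable V : finType.

Definition cone_rel (H : sgraph V) (x y : option V) : bool :=
  if x is Some a then if y is Some b then adj H a b else true else true.

Definition cone (H : sgraph V) : sgraph (option V) := graph_of_rel (cone_rel H).

Lemma adj_cone_Some H a b : adj (cone H) (Some a) (Some b) = adj H a b.
Proof.
rewrite adj_graph_of_rel /= [adj H b a]adjC orbb.
by case: eqVneq => [[->]|//]; rewrite adjxx.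
Qed.

Lemma adj_cone_apex H x : adj (cone H) None x = (x != None).
Proof. by rewrite adj_graph_of_rel /= andbT eq_sym. Qed.

Lemma step_cone_apex H x : step (cone H) None x.
Proof. by rewrite /step adj_cone_apex eq_sym orbN. Qed.

Lemma connected_cone H : connected_graph (cone H).
Proof.
apply: (@connected_graph_root _ _ None) => x.
have [->//|xN] := eqVneq x None; apply: connect1.
by rewrite adjC adj_cone_apex.
Qed.

Lemma cop_number_cone H : cop_number (cone H) = 1.
Proof.
apply/eqP; rewrite eqn_leq (cop_number_gt0 _ None) andbT; apply: cop_number_leq.
(* The cop starts at the apex, answers the robber's placement by moving onto it, and stays there. *)
exists (fun h _ => head None h); split=> [h r i|rho _].
  by case: h => [|a h]; rewrite /= ?step_refl ?step_cone_apex.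
by exists 0, ord0; right.
Qed.

(* An isomorphism may move the apex, but only to another universal vertex,
   which is swapped with the apex by an automorphism. *)
Lemma cone_iso_inv H H' : sgraph_iso (cone H) (cone H') -> sgraph_iso H H'.
Proof.
case/sgraph_isoP=> p pP; pose w := p None.
have wP y : adj (cone H') w y = (y != w).
  by rewrite -[y](permKV p) pP adj_cone_apex (inj_eq (@perm_inj _ p) _ None).
pose q := (p * tperm None w)%g.
have qN : q None = None by rewrite permM tpermR.
have tP x y : adj (cone H') (tperm None w x) (tperm None w y) = adj (cone H') x y.
  have NP := adj_cone_apex H'.
  case: tpermP => [->|->|/eqP x0 /eqP xw]; case: tpermP => [->|->|/eqP y0 /eqP yw];
    rewrite ?adjxx ?[adj _ x _]adjC ?wP ?NP ?x0 ?xw ?y0 ?yw // eq_sym //.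
apply: (@sgraph_iso_restrict _ _ (cone H) (cone H') H H' Some q).
- by move=> a b [].
- exact: adj_cone_Some.
- exact: adj_cone_Some.
- by move=> x y; rewrite !permM tP pP.
move=> a; case qa: (q (Some a)) => [b|]; first by exists b.
by have /perm_inj : q (Some a) = q None by rewrite qa qN.
Qed.

End Cone.

(** * A cone joined by an edge to a vertex of [M] *)

Section Pendant.
Variables (U V : finType) (M : sgraph U) (x : U).

Definition pendant_rel (H : sgraph V) (y z : U + option V) : bool :=
  match y, z with
  | inl a, inl b => adj M a b
  | inr a, inr b => adj (cone H) a b
  | inl a, inr b => (a == x) && (b == None)
  | inr _, inl _ => false
  end.

Definition pendant_cone (H : sgraph V) : sgraph (U + option V)%type :=
  graph_of_rel (pendant_rel H).

Lemma adj_pendant_ll H a b : adj (pendant_cone H) (inl a) (inl b) = adj M a b.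
Proof.
rewrite adj_graph_of_rel /= [adj M b a]adjC orbb.
by case: eqVneq => [[->]|//]; rewrite adjxx.
Qed.

Lemma adj_pendant_rr H a b :
  adj (pendant_cone H) (inr a) (inr b) = adj (cone H) a b.
Proof.
rewrite adj_graph_of_rel /= [adj _ b a]adjC orbb.
by case: eqVneq => [[->]|//]; rewrite adjxx.
Qed.

Lemma adj_pendant_lr H a b :
  adj (pendant_cone H) (inl a) (inr b) = (a == x) && (b == None).
Proof. by rewrite adj_graph_of_rel /= orbF. Qed.

Lemma adj_pendant_rl H a b :
  adj (pendant_cone H) (inr b) (inl a) = (a == x) && (b == None).
Proof. by rewrite adjC adj_pendant_lr. Qed.

Definition adj_pendant :=
  (adj_pendant_ll, adj_pendant_rr, adj_pendant_lr, adj_pendant_rl).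

Lemma connected_pendant_cone H :
  connected_graph M -> connected_graph (pendant_cone H).
Proof.
move=> /connected_graphP[_ cM]; apply: (@connected_graph_root _ _ (inl x)) => -[a|b].
  by apply: connect_homo (cM a x) => ? ?; rewrite adj_pendant.
apply: (@connect_trans _ _ (inr None)); last first.
  by apply: connect1; rewrite adj_pendant !eqxx.
have /connected_graphP[_ cC] := connected_cone H.
by apply: connect_homo (cC b None) => ? ?; rewrite adj_pendant.
Qed.

Definition shadow (y : U + option V) : U := if y is inl a then a else x.

Lemma step_shadow H y z :
  step (pendant_cone H) y z -> step M (shadow y) (shadow z).
Proof.
case/orP=> [/eqP->|]; first exact: step_refl.
case: y z => [a|a] [b|b]; rewrite adj_pendant /= /step ?eqxx //.
- by move=> ->; rewrite orbT.
- by case/andP=> ->.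
by case/andP=> /eqP->; rewrite eqxx.
Qed.

Lemma step_pendant_inl H a b : step M a b -> step (pendant_cone H) (inl a) (inl b).
Proof. by rewrite /step adj_pendant => /orP[/eqP->|->]; rewrite ?eqxx ?orbT. Qed.

Lemma step_pendant_apex H b : step (pendant_cone H) (inr None) (inr b).
Proof.
by have := step_cone_apex H b; rewrite /step adj_pendant => /orP[/eqP<-|->];
   rewrite ?eqxx ?orbT.
Qed.

Lemma cop_number_pendant_cone_geq H : cop_number M <= cop_number (pendant_cone H).
Proof.
apply: (@cop_number_retract _ _ _ _ inl shadow) => // y z.
  exact: step_pendant_inl.
exact: step_shadow.
Qed.

(** * Lifting a winning strategy from [M] *)

Section Strategy.
Variables (H : sgraph V) (k : nat) (s : cop_strategy U k).
Let G := pendant_cone H.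

(* Each cop captures the robber if it can; else it moves onto the shadow of the
   robber if it can, or from [x] to the apex if it is already there; else it
   imitates its move in [M]. The argument is the reversed history. *)
Fixpoint chase (h : seq (U + option V)) (i : 'I_k) : U + option V :=
  if h is r :: h' then
    let c := chase h' i in
    let m := inl (s (map shadow (rev h)) i) in
    if step G c r then r
    else if step G c (inl (shadow r)) then
      if c == inl x then inr None else inl (shadow r)
    else if step G c m then m else c
  else inl (s [::] i).

Lemma chase_legal : legal_strategy G (fun h => chase (rev h)).
Proof.
move=> h r i; rewrite rev_rcons /=; case: ifP => // _; case: ifP => [st|_].
  by case: ifP => // /eqP->; rewrite /step adj_pendant !eqxx.
by case: ifP => // _; apply: step_refl.
Qed.

(** If the robber stays free, no cop ever gets within a step of the robber, nor of its shadow: such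
    a cop would reach [x] with the robber in the cone, then the apex, and catch it. So all cops
    imitate [s] forever, and the capture of the shadow by [s] is a contradiction. *)
Lemma chase_captures (rho : nat -> U + option V) :
  legal_strategy M s -> captured s (shadow \o rho) -> robber_walk G rho ->
  captured (fun h => chase (rev h)) rho.
Proof.
move=> sL [t0 [i0 cap0]] rhoW; apply: contrapT => free.
pose C t := chase (rev (mkseq rho t)).
have CS t i : C t.+1 i =
    if step G (C t i) (rho t) then rho t
    else if step G (C t i) (inl (shadow (rho t))) then
      if C t i == inl x then inr None else inl (shadow (rho t))
    else let m := inl (s (mkseq (shadow \o rho) t.+1) i) in
      if step G (C t i) m then m else C t i.
  by rewrite /C mkseqS_rcons rev_rcons /= rev_cons revK -mkseqS_rcons map_mkseq.
have far t i : step G (C t i) (rho t) = false.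
  apply/negP=> st; apply: free; exists t, i; right.
  by have := CS t i; rewrite st /C.
have at_apex t i y : C t i = inr None -> rho t = inr y -> False.
  by move=> Ci rt; have := far t i; rewrite Ci rt step_pendant_apex.
have outside t i : step G (C t i) (inl (shadow (rho t))) ->
    exists y, rho t = inr y.
  by have := far t i; case: (rho t) => [a|y] /=; [move->|exists y].
(* From the apex the cop reaches the whole cone and [x], the robber's only exit. *)
have at_x t i : C t i = inl x -> step G (C t i) (inl (shadow (rho t))) -> False.
  move=> Cx st; have [y ry] := outside _ _ st.
  have Cu : C t.+1 i = inr None by rewrite CS far st Cx eqxx.
  case ry': (rho t.+1) => [a|y']; last by case: (at_apex _ _ _ Cu ry').
  have := rhoW t; rewrite ry ry' /step adj_pendant_rl => /andP[/eqP ax _].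
  by have := far t.+1 i; rewrite Cu ry' /step adj_pendant ax !eqxx.
(* The shadow is then [x]; the cop moves there, and the shadow of the robber's next position is
   still within a step. *)
have away t i : step G (C t i) (inl (shadow (rho t))) = false.
  apply/negP=> st; have [y ry] := outside _ _ st.
  have Cx : C t.+1 i = inl x.
    have [Cx|nx] := eqVneq (C t i) (inl x); first by case: (at_x _ _ Cx st).
    by rewrite CS far st (negbTE nx) ry.
  apply: (at_x t.+1 i Cx); rewrite Cx; apply: step_pendant_inl.
  by have := step_shadow (rhoW t); rewrite ry.
have imitate t i : C t i = inl (s (mkseq (shadow \o rho) t) i).
  elim: t => [//|t IH]; rewrite CS far away /= IH.
  by rewrite step_pendant_inl // mkseqS_rcons; apply: sL.
have := away t0 i0; rewrite imitate step_pendant_inl //.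
rewrite -[shadow _]/((shadow \o rho) t0); case: cap0 => <-; first exact: step_refl.
by rewrite mkseqS_rcons; apply: sL.
Qed.

End Strategy.

Lemma cop_number_pendant_cone H : cop_number (pendant_cone H) = cop_number M.
Proof.
apply/eqP; rewrite eqn_leq cop_number_pendant_cone_geq andbT.
apply: cop_number_leq; have [s [sL sW]] := cop_number_win M.
exists (fun h => chase H s (rev h)); split=> [|rho rhoW]; first exact: chase_legal.
apply: chase_captures => //; apply: sW => t; exact: step_shadow (rhoW t).
Qed.

(** * Degrees and recovery of [H] *)

Lemma degree_pendant_apex H : #|V| < degree (pendant_cone H) (inr None).
Proof.
pose f (o : option V) : U + option V := if o is Some b then inr (Some b) else inl x.
have fI : injective f by move=> [a|] [b|] //= [->].
rewrite -card_option -(card_imset _ fI); apply/subset_leq_card/subsetP.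
move=> _ /imsetP[[b|] _ ->]; rewrite inE adj_pendant ?adj_cone_apex //.
by rewrite !eqxx.
Qed.

(** The apex, possibly a neighbour of [y], is counted in the place of [y], which is not its own
    neighbour; hence the bound [#|U|] for [y] in [M] and [#|V|] for [y] in the cone. *)
Lemma degree_pendant_leq H y : #|U| <= #|V| -> y != inr None ->
  degree (pendant_cone H) y <= #|V|.
Proof.
move=> UV; case: y => [a|[b|]] // _.
  apply: leq_trans UV; rewrite -cardsT.
  pose f b : U + option V := if b == a then inr None else inl b.
  apply: leq_trans (leq_imset_card f _); apply/subset_leq_card/subsetP.
  move=> [c|c]; rewrite inE adj_pendant => ac; apply/imsetP.
    exists c => //; rewrite /f; case: eqVneq => // ca.
    by rewrite ca adjxx in ac.
  by exists a => //; rewrite /f eqxx; case/andP: ac => _ /eqP->.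
rewrite -cardsT; pose f c : U + option V := if c == b then inr None else inr (Some c).
apply: leq_trans (leq_imset_card f _); apply/subset_leq_card/subsetP.
move=> [c|[c|]]; rewrite inE adj_pendant ?andbF ?adj_cone_Some // => bc.
  apply/imsetP; exists c => //; rewrite /f; case: eqVneq => // cb.
  by rewrite cb adjxx in bc.
by apply/imsetP; exists b => //; rewrite /f eqxx.
Qed.

(* The apex is the only vertex of degree larger than [#|V|], and [x] is the
   only neighbour of the apex with a neighbour that is not adjacent to the apex. *)
Lemma pendant_cone_iso_inv H H' : #|U| <= #|V| -> (exists y, adj M x y) ->
  sgraph_iso (pendant_cone H) (pendant_cone H') -> sgraph_iso H H'.
Proof.
move=> UV [y xy] /sgraph_isoP[p pP]; pose u : U + option V := inr None.
have pu : p u = u.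
  apply/eqP; apply: contraTT (degree_pendant_apex H) => /(degree_pendant_leq H' UV).
  rewrite -leqNgt; apply: leq_trans.
  rewrite /degree -(card_imset _ (@perm_inj _ p)); apply/subset_leq_card/subsetP.
  by move=> _ /imsetP[z zP ->]; rewrite !inE in zP *; rewrite pP.
have pPu z : adj (pendant_cone H') u (p z) = adj (pendant_cone H) u z.
  by rewrite -{1}pu pP.
have pneq z : z != u -> p z != u by rewrite -{2}pu (inj_eq (@perm_inj _ p)).
have px : p (inl x) = inl x.
  have yx : y != x by apply: contraTneq xy => ->; rewrite adjxx.
  have [y' py] : exists y', p (inl y) = inl y'.
    case pyE: (p (inl y)) => [y'|[b|]]; first by exists y'.
      by have := pPu (inl y); rewrite pyE !adj_pendant adj_cone_apex (negbTE yx).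
    by have := pneq (inl y) isT; rewrite pyE eqxx.
  have := pP (inl x) (inl y); have := pPu (inl x).
  rewrite py adj_pendant_ll xy adj_pendant_rl !eqxx.
  case: (p (inl x)) => [a|[b|]]; rewrite !adj_pendant ?andbF ?adj_cone_apex //.
  by case/andP=> /eqP->.
apply: (@sgraph_iso_restrict _ _ (pendant_cone H) (pendant_cone H') H H'
  (fun a => inr (Some a)) p) => //.
- by move=> a b [].
- by move=> a b; rewrite adj_pendant adj_cone_Some.
- by move=> a b; rewrite adj_pendant adj_cone_Some.
(* Neighbours of the apex other than [x] are sent to neighbours of the apex other than [x], that is,
   into the copy of [V]. *)
move=> a; have := pPu (inr (Some a)); have := pneq (inr (Some a)) isT.
case pa: (p (inr (Some a))) => [b|[b|]] // _; last by exists b.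
rewrite !adj_pendant adj_cone_apex /= => /andP[/eqP bx _].
by have /perm_inj : p (inr (Some a)) = p (inl x) by rewrite px pa bx.
Qed.

End Pendant.

(** * Deleting a vertex *)

Section DeleteVertex.
Variables (n : nat) (G : sgraph 'I_n.+1).

Definition delete_vertex (v : 'I_n.+1) : sgraph 'I_n := graph_preim (lift v) G.

(* The additional cop guards [v]. *)
Lemma cop_number_delete_vertex v :
  0 < n -> cop_number G <= (cop_number (delete_vertex v)).+1.
Proof.
move=> n0; pose w : 'I_n := Ordinal n0; apply: cop_number_leq.
have [s [sL sW]] := cop_number_win (delete_vertex v).
(* [w] is a mere default at [v]: a robber who ever visits [v] is caught by the guard, the cop
   [ord_max]. *)
pose proj y := odflt w (unlift v y).
have projK y : y != v -> lift v (proj y) = y.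
  by rewrite eq_sym /proj; case: unliftP => [z ->|->]; rewrite ?eqxx.
have stepE a b : step (delete_vertex v) a b = step G (lift v a) (lift v b).
  by rewrite /step adj_graph_preim (inj_eq lift_inj).
exists (fun h i => if unlift ord_max i is Some j then lift v (s (map proj h) j) else v).
split=> [h r i|rho rhoW].
  case: unliftP => [j _|_]; last exact: step_refl.
  by rewrite -stepE map_rcons.
have [[t rt]|nv] := pselect (exists t, rho t = v).
  by exists t, ord_max; left; rewrite unlift_none.
have rhoK t : lift v (proj (rho t)) = rho t.
  by apply: projK; apply/eqP=> rt; apply: nv; exists t.
have [|t [j cap]] := sW (proj \o rho); first by move=> t; rewrite stepE /= !rhoK.
exists t, (lift ord_max j); rewrite !map_mkseq liftK.
by case: cap => ->; [left|right]; rewrite /= rhoK.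
Qed.

(* A maximal proper subset inducing a connected subgraph misses one vertex. *)
Lemma exists_noncut_vertex : 0 < n -> connected_graph G ->
  exists v, connected_graph (delete_vertex v).
Proof.
move=> n0 /connected_graphP[_ cG].
pose eS (S : {set 'I_n.+1}) a b := [&& a \in S, b \in S & adj G a b].
have eSC S : symmetric (eS S).
  by move=> a b; rewrite /eS adjC andbCA.
pose P (S : {set 'I_n.+1}) := [&& S != set0, S != setT &
  [forall a in S, forall b in S, connect (eS S) a b]].
have P0 : P [set ord0].
  apply/and3P; split.
  - by apply/set0Pn; exists ord0; rewrite inE.
  - apply/eqP=> /setP/(_ ord_max); rewrite !inE => /eqP/(congr1 val) /= E.
    by rewrite E in n0.
  by apply/forall_inP=> a /set1P->; apply/forall_inP=> b /set1P->.
case: (@arg_maxnP _ [set ord0] P (fun S => #|S|) P0) => S PS Smax.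
case/and3P: PS => /set0Pn[a aS] ST /forall_inP cS.
have {}cS b c : b \in S -> c \in S -> connect (eS S) b c.
  by move=> bS; move/forall_inP: (cS b bS); apply.
(* A path from [a] to a vertex outside [S] leaves [S] along some edge. *)
have [b [c [bS cNS bc]]] : exists b c, [/\ b \in S, c \notin S & adj G b c].
  have [d dNS] : exists d, d \notin S.
    apply/existsP; apply: contraNT ST; rewrite negb_exists => /forallP all.
    by apply/eqP/setP=> d; rewrite inE; have := all d; rewrite negbK.
  apply: contrapT => no; case/negP: dNS.
  have /connectP[p] := cG a d; elim: p a aS => [|e p IH] a aS /=.
    by move=> _ ->.
  case/andP=> ae; apply: IH; apply: contraT => eNS.
  by case: no; exists a, e.
(* The edge between [b] and [c] keeps [c |: S] connected, so by maximality it cannot be proper. *)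
have ScT : c |: S = setT.
  apply: contraTeq isT => nT; suff: P (c |: S).
    by move/Smax => /=; rewrite leqNgt cardsU1 cNS add1n leqnn.
  apply/and3P; split=> //; first by apply/set0Pn; exists c; rewrite setU11.
  have cb d : d \in c |: S -> connect (eS (c |: S)) d b.
    case/setU1P=> [->|dS].
      by apply: connect1; rewrite /eS !inE eqxx bS orbT adjC.
    apply: connect_sub (cS _ _ dS bS) => y z /and3P[yS zS yz].
    by apply: connect1; rewrite /eS !inE yS zS yz !orbT.
  apply/forall_inP=> d dS; apply/forall_inP=> e eS'.
  apply: connect_trans (cb _ dS) _.
  by rewrite (sym_connect_sym (@eSC _)); apply: cb.
have SE y : (y \in S) = (y != c).
  have := in_setT y; rewrite -ScT !inE => /orP[/eqP->|yS].
    by rewrite eqxx (negbTE cNS).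
  by rewrite yS; apply/esym; apply: contraNneq cNS => <-.
exists c; apply/connected_graphP; split=> [|y z]; first by rewrite card_ord.
have liftS d : lift c d \in S by rewrite SE eq_sym neq_lift.
pose proj d := odflt y (unlift c d).
have projK d : proj (lift c d) = d by rewrite /proj liftK.
rewrite -[y]projK -[z]projK; apply: connect_homo (cS _ _ (liftS y) (liftS z)).
move=> d e /and3P[]; rewrite !SE ![_ == c]eq_sym.
by move=> /unlift_some[d' -> _] /unlift_some[e' -> _]; rewrite adj_graph_preim !projK.
Qed.

End DeleteVertex.

(** * Connected graphs of minimum order, and the conclusion *)

Lemma mincop_orderP k :
  exists2 G : sgraph 'I_(mincop_order k), connected_graph G & k <= cop_number G.
Proof.
rewrite /mincop_order; case: ex_minnP => m /existsP[G /andP[cG kG]] _.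
by exists G.
Qed.

Lemma mincop_order_leq k m (G : sgraph 'I_m) :
  connected_graph G -> k <= cop_number G -> mincop_order k <= m.
Proof.
move=> cG kG; rewrite /mincop_order; case: ex_minnP => m' _; apply.
by apply/existsP; exists G; rewrite cG.
Qed.

Lemma mincop_cop_number k (G : sgraph 'I_(mincop_order k)) : 0 < k ->
  connected_graph G -> k <= cop_number G -> cop_number G = k.
Proof.
move=> k0 cG kG; apply/eqP; rewrite eqn_leq kG andbT leqNgt; apply/negP=> ltkG.
have cardG : cop_number G <= mincop_order k.
  by have := cop_number_leq (cops_win_card G); rewrite card_ord.
(* [minG] is stated before the order is generalised to the form [m.+1] that [delete_vertex]
   requires. *)
have minG := @mincop_order_leq k.
move: (mincop_order k) G cG kG ltkG cardG minG => [|m] G cG kG ltkG cardG minG.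
  by move: cardG; rewrite leqn0 => /eqP E; rewrite E in ltkG.
(* The cop number exceeds [k], so it is at least 2, and so is the number of vertices. *)
have m0 : 0 < m by rewrite -ltnS (leq_trans _ cardG) // (leq_trans _ ltkG).
have [v cv] := exists_noncut_vertex m0 cG.
have lt : cop_number (delete_vertex G v) < k.
  by rewrite ltnNge; apply/negP=> /(minG _ _ cv); rewrite ltnn.
by have := leq_trans (cop_number_delete_vertex G v m0) lt; rewrite leqNgt ltkG.
Qed.

Theorem theorem4 :
  (forall n : nat, 1 < n -> num_graphs (n - 1) <= num_cop_graphs 1 n) /\
  (forall k n : nat, 1 < k -> 2 * mincop_order k < n ->
     num_graphs (n - mincop_order k - 1) <= num_cop_graphs k n).
Proof.
split=> [n n1|k n k1 mn].
  apply: (num_graphs_leq (F := @cone _)).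
  - by rewrite card_option card_ord; lia.
  - exact: connected_cone.
  - exact: cop_number_cone.
  - exact: cone_iso_inv.
have [M cM kM] := mincop_orderP k.
have Mk := mincop_cop_number (ltnW k1) cM kM.
(* A graph has at least as many vertices as its cop number; a second vertex gives [x] a
   neighbour. *)
have m1 : 1 < mincop_order k.
  apply: leq_trans k1 _; apply: leq_trans kM _.
  by have := cop_number_leq (cops_win_card M); rewrite card_ord.
pose x : 'I_(mincop_order k) := Ordinal (ltnW m1).
have [y xy] : exists y, adj M x y.
  have /connected_graphP[_ /(_ x (Ordinal m1))/connectP[[|y p] /=]] := cM.
    by move=> _ /(congr1 val).
  by case/andP=> xy _ _; exists y.
apply: (num_graphs_leq (F := pendant_cone M x)).
- by rewrite card_sum card_option !card_ord; lia.
- by move=> H; apply: connected_pendant_cone.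
- by move=> H; rewrite cop_number_pendant_cone.
- move=> H H'; apply: pendant_cone_iso_inv; last by exists y.
  (* [n > 2 m_k] says that [M] has at most [n - m_k - 1] vertices, the order of [H]. *)
  by rewrite !card_ord; lia.
Qed.
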